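(* Let $a<b$ be real and let $c=(a+b)/2$. For a monic quadratic polynomial $\phi$ with real coefficients and a polynomial $f:[a,b]\to\mathbb{R}$, define $E(f)=E_\phi(f)$ by $$\int_a^b f(x)\,dx=\tfrac12\left[-f(a)\phi'(a)+f(b)\phi'(b)+f'(a)\phi(a)-f'(b)\phi(b)\right]+E(f).$$ (a) If $f$ is a linear function (i.e. $f(x)=Ax+B$ with $A,B\in\mathbb{R}$), then $E(f)=0$ for all such $\phi$. (b) $E(f)=0$ for all cubic polynomials $f$ if and only if $\phi(x)=(x-c)^2-(b-a)^2/12$.
   Context: ''Cubic polynomials'' means real polynomials of degree at most $3$. *)

(* Defs.v *)
From HB Require Import structures.
From mathcomp Require Import all_boot all_order all_algebra.
From mathcomp Require Import all_classical all_reals all_analysis.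
Set Implicit Arguments.
Unset Strict Implicit.
Unset Printing Implicit Defensive.
Import Order.TTheory GRing.Theory Num.Theory.
Import numFieldNormedType.Exports.
Local Open Scope classical_set_scope.
Local Open Scope ring_scope.

(* [size p] is the degree plus one, so this says: monic of degree exactly 2. *)
Definition monic_quadratic (R : realType) (phi : {poly R}) : Prop :=
  phi \is monic /\ size phi = 3%N.

Definition midpoint (R : realType) (a b : R) : R := (a + b) / 2.

Definition quad_rule (R : realType) (a b : R) (phi f : {poly R}) : R :=
  2^-1 * (- (f.[a] * phi^`().[a]) + f.[b] * phi^`().[b]
          + f^`().[a] * phi.[a] - f^`().[b] * phi.[b]).

(* The error term, i.e. the unique real number E such that
   \int_a^b f = quad_rule a b phi f + E. *)
Definition quad_error (R : realType) (a b : R) (phi f : {poly R}) : R :=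
  (\int[lebesgue_measure]_(x in `[a, b]) f.[x])%R - quad_rule a b phi f.

(* Main.v *)
(** Since [phi'' = 2], the polynomial [(f phi' - f' phi)' + f'' phi] equals [2 f],
    so that [E f] is half the integral of [f'' phi] over [[a, b]]. Hence [E] vanishes
    on linear functions, and it vanishes on cubics iff [phi] is orthogonal to all
    linear functions, which determines [phi] as the monic quadratic Legendre
    polynomial of [[a, b]]. *)
Require Import Defs.
From HB Require Import structures.
From mathcomp Require Import all_boot all_order all_algebra.
From mathcomp Require Import all_classical all_reals all_analysis.
From mathcomp Require Import ring.
Set Implicit Arguments.
Unset Strict Implicit.
Unset Printing Implicit Defensive.
Import Order.TTheory GRing.Theory Num.Theory.
Import numFieldNormedType.Exports.
Local Open Scope classical_set_scope.
Local Open Scope ring_scope.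

Lemma Rintegral_deriv_poly (R : realType) (a b : R) (F : {poly R}) : a < b ->
  (\int[lebesgue_measure]_(x in `[a, b]) F^`().[x])%R = F.[b] - F.[a].
Proof.
move=> ab; rewrite /Rintegral (@continuous_FTC2 R _ (horner F) a b) //.
- by apply: continuous_subspaceT => x; exact: continuous_horner.
- split=> [x _||]; first exact: derivable_horner.
  + by apply: cvg_at_right_filter; exact: continuous_horner.
  + by apply: cvg_at_left_filter; exact: continuous_horner.
- by move=> x _; rewrite derivE.
Qed.

Lemma size_le2_polyXsubC (R : comNzRingType) (p : {poly R}) (c : R) :
  (size p <= 2)%N -> p = p`_1 *: ('X - c%:P) + p.[c]%:P.
Proof.
move=> p2; rewrite (horner_coef_wide c p2) !big_ord_recl big_ord0 /=.
apply/polyP => -[|[|i]]; rewrite !coefE /=; try ring.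
by rewrite nth_default ?(leq_trans p2) //; ring.
Qed.

(** Subtracting [('X - c%:P) ^+ 2] cancels the leading term, and the remainder, of degree at most 1,
    is expanded about [c]. *)
Lemma monic_quadratic_centered (R : realType) (phi : {poly R}) (c : R) :
  monic_quadratic phi ->
  exists p q : R, phi = ('X - c%:P) ^+ 2 + p *: ('X - c%:P) + q%:P.
Proof.
move=> [/monicP]; rewrite lead_coefE => + phi3; rewrite phi3 /= => phi2.
pose psi := phi - ('X - c%:P) ^+ 2.
have psi2 : (size psi <= 2)%N.
  apply/leq_sizeP => -[|[|[|i]]] // _.
    by rewrite /psi coefB phi2 expr2 mulrBl !mulrBr !coefE /=; ring.
  rewrite /psi coefB nth_default ?phi3 // nth_default ?subrr //.
  by rewrite size_exp_XsubC.
exists psi`_1, psi.[c].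
by rewrite -addrA -(size_le2_polyXsubC c psi2) addrC subrK.
Qed.

(** Working with a primitive [G] of [f'' phi] makes [(f phi' - f' phi + G) / 2] a primitive of [f];
    its boundary values without [G] are exactly [quad_rule]. *)
Lemma quad_error_primitive (R : realType) (a b : R) (phi f G : {poly R}) :
  a < b -> monic_quadratic phi -> G^`() = f^`()^`() * phi ->
  quad_error a b phi f = 2^-1 * (G.[b] - G.[a]).
Proof.
(* The centre 0 is arbitrary: the expansion only serves to compute [phi'']. *)
move=> ab /(monic_quadratic_centered 0)[p [q phiE]] dG.
have phi2 : phi^`()^`() = 2%:P.
  rewrite phiE !poly.derivE /=.
  by ring.
pose F : {poly R} := 2^-1 *: (f * phi^`() - f^`() * phi + G).
have dF : F^`() = f.
  rewrite /F !poly.derivE dG phi2.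
  rewrite (_ : _ + _ = 2%:P * f); last by ring.
  by rewrite mul_polyC scalerA mulVf ?scale1r.
rewrite /quad_error.
have -> : (\int[lebesgue_measure]_(x in `[a, b]) f.[x])%R = F.[b] - F.[a].
  by rewrite -Rintegral_deriv_poly // dF.
rewrite /quad_rule /F !hornerE.
by field.
Qed.

(** In the variable [u = x - c] the interval is [[-h, h]], so only the even part
    [(r p + s) u^2 + s q] of [f'' phi] contributes. *)
Lemma quad_error_centered (R : realType) (a b p q r s : R) (phi f : {poly R})
    (c := midpoint a b) (h := (b - a) / 2) :
  a < b -> monic_quadratic phi ->
  phi = ('X - c%:P) ^+ 2 + p *: ('X - c%:P) + q%:P ->
  f^`()^`() = r *: ('X - c%:P) + s%:P ->
  quad_error a b phi f = r * (p * h ^+ 3 / 3) + s * (h * (h ^+ 2 / 3 + q)).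
Proof.
move=> ab mphi phiE d2f; pose u : {poly R} := 'X - c%:P.
(* Termwise primitive of [(r u + s) (u^2 + p u + q)], over the common denominator 12. *)
pose G : {poly R} := 12^-1 *: ((3 * r) *: u ^+ 4 + (4 * (r * p + s)) *: u ^+ 3
  + (6 * (r * q + s * p)) *: u ^+ 2 + (12 * s * q) *: u).
have dG : G^`() = f^`()^`() * phi.
  rewrite d2f phiE -/u /G !poly.derivE -!mul_polyC.
  rewrite [X in _ * X = _](_ : _ =
    12%:P * ((r%:P * u + s%:P) * (u ^+ 2 + p%:P * u + q%:P))); last by ring.
  by rewrite mulrA -polyCM mulVf ?mul1r // pnatr_eq0.
rewrite (quad_error_primitive ab mphi dG) /G /u !hornerE /= /c /h /midpoint.
by field.
Qed.

Theorem theorem6p1 (R : realType) (a b : R) (hab : a < b) :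
  (forall (phi : {poly R}) (A B : R), monic_quadratic phi ->
     quad_error a b phi (A *: 'X + B%:P) = 0) /\
  (forall phi : {poly R}, monic_quadratic phi ->
     ((forall f : {poly R}, (size f <= 4)%N -> quad_error a b phi f = 0) <->
      phi = ('X - (midpoint a b)%:P) ^+ 2 - ((b - a) ^+ 2 / 12)%:P)).
Proof.
split=> [phi A B mphi|phi mphi].
  rewrite (@quad_error_primitive _ _ _ _ _ 0) ?horner0 ?subrr ?mulr0 //.
  by rewrite !poly.derivE scaler0 addr0 mul0r.
pose c := midpoint a b; pose h := (b - a) / 2.
have h0 : h != 0 by rewrite mulf_neq0 ?invr_eq0 ?subr_eq0 ?(gt_eqF hab).
split=> [E0|phiE f f4].
  have [p [q phiE]] := monic_quadratic_centered c mphi.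
  have uXn n : (size (('X - c%:P) ^+ n : {poly R})%R <= n.+1)%N.
    by rewrite size_exp_XsubC.
  (* This test cubic has [f'' = 'X - c%:P], so its error isolates [p]. *)
  have := E0 (6^-1 *: ('X - c%:P) ^+ 3) (leq_trans (size_scale_leq _ _) (uXn 3)).
  rewrite (quad_error_centered (r := 1) (s := 0) hab mphi phiE); last first.
    rewrite !poly.derivE -!mul_polyC.
    apply: (mulfI (x := 6%:P)); first by rewrite polyC_eq0 pnatr_eq0.
    by rewrite mulrA -polyCM mulfV ?pnatr_eq0 //; ring.
  (* Here [f'' = 1], which isolates [h^2 / 3 + q]. *)
  have := E0 (2^-1 *: ('X - c%:P) ^+ 2)
    (leq_trans (leq_trans (size_scale_leq _ _) (uXn 2)) (leqnSn _)).
  rewrite (quad_error_centered (r := 0) (s := 1) hab mphi phiE); last first.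
    rewrite !poly.derivE -!mul_polyC.
    apply: (mulfI (x := 2%:P)); first by rewrite polyC_eq0 pnatr_eq0.
    by rewrite mulrA -polyCM mulfV ?pnatr_eq0 //; ring.
  rewrite -/h !mul0r !mul1r add0r addr0 => /eqP.
  rewrite mulf_eq0 (negPf h0) /= addrC addr_eq0 => /eqP qE /eqP.
  rewrite mulf_eq0 invr_eq0 pnatr_eq0 orbF mulf_eq0 expf_eq0 (negPf h0) orbF.
  move=> /eqP p0; rewrite phiE p0 qE scale0r addr0 polyCN.
  by congr (_ - _%:P); rewrite /h; field.
have d2f : (size f^`()^`() <= 2)%N.
  by apply/leq_sizeP => i i2; rewrite !coef_deriv nth_default ?mul0rn // (leq_trans f4).
(* With [p = 0] and [q = - h^2 / 3], both terms of the error formula vanish for every affine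
   [f'']. *)
have phiE0 : phi = ('X - c%:P) ^+ 2 + 0 *: ('X - c%:P) + (- ((b - a) ^+ 2 / 12))%:P.
  by rewrite phiE scale0r addr0 polyCN.
rewrite (quad_error_centered hab mphi phiE0 (size_le2_polyXsubC c d2f)).
by field.
Qed.
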